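(* The lattice $\mathcal{L}(\mathbf{NF}_3)$ of subvarieties of $\mathbf{NF}_3$ has cardinality of the continuum. Moreover, it contains both a chain and an antichain of cardinality $2^{\aleph_0}$.
   Context: An additively idempotent semiring (ai-semiring) is an algebra $(S,+,\cdot)$ with two binary operations such that $(S,+)$ is a commutative idempotent semigroup, $(S,\cdot)$ is a semigroup, and both distributive laws $(x+y)z=xz+yz$, $x(y+z)=xy+xz$ hold. A flat semiring is an ai-semiring $S$ whose multiplicative reduct has a zero element $0$ and in which $a+b=0$ for all distinct $a,b\in S$. It is $3$-nilpotent if $a_1a_2a_3=0$ for all $a_1,a_2,a_3\in S$. $\mathbf{NF}_3$ is the variety (in the signature $(+,\cdot)$) generated by all $3$-nilpotent flat semirings. The lattice of subvarieties is ordered by inclusion. *)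

(* Defs.v *)
From mathcomp Require Import all_boot.
From mathcomp Require Import boolp classical_sets functions cardinality.

Set Implicit Arguments.
Unset Strict Implicit.
Unset Printing Implicit Defensive.

Local Open Scope classical_set_scope.

(* Carriers are nonempty, as usual in universal algebra. *)
Record alg := Alg {
  carrier :> Type;
  add : carrier -> carrier -> carrier;
  mul : carrier -> carrier -> carrier;
  alg_inhabited : inhabited carrier }.

Declare Scope alg_scope.
Delimit Scope alg_scope with alg.
Local Open Scope alg_scope.
Notation "x + y" := (add x y) : alg_scope.
Notation "x * y" := (mul x y) : alg_scope.

Definition is_hom (A B : alg) (f : A -> B) : Prop :=
  (forall x y, f (x + y) = f x + f y) /\ (forall x y, f (x * y) = f x * f y).

Lemma prod_inhabited (I : Type) (A : I -> alg) :
  inhabited (forall i, A i).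
Proof.
have ex i : exists _ : A i, True by case: (alg_inhabited (A i)) => x; exists x.
by split=> i; exact: (projT1 (cid (ex i))).
Qed.

Definition prod_alg (I : Type) (A : I -> alg) : alg :=
  @Alg (forall i, A i) (fun x y i => x i + y i) (fun x y i => x i * y i)
    (prod_inhabited A).

(* Closure under H, S and P. Subalgebras are taken up to isomorphism, i.e.,   *)
(* as domains of embeddings. The empty product (the one-element algebra)      *)
(* belongs to every variety.                                                  *)
Definition variety (V : set alg) : Prop :=
  [/\ forall (A B : alg) (f : A -> B),
        is_hom f -> (forall b, exists a, f a = b) -> V A -> V B,
      forall (A B : alg) (f : A -> B),
        is_hom f -> injective f -> V B -> V A
    & forall (I : Type) (A : I -> alg),
        (forall i, V (A i)) -> V (prod_alg A)].

Definition generated_variety (K : set alg) : set alg := smallest variety K.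

Definition subvarieties (V : set alg) : set (set alg) :=
  [set W | variety W /\ W `<=` V].

Definition ai_semiring (S : alg) : Prop :=
  [/\ associative (@add S), commutative (@add S), idempotent_op (@add S),
      associative (@mul S)
    & left_distributive (@mul S) (@add S) /\
      right_distributive (@mul S) (@add S)].

Definition mul_zero (S : alg) (z : S) : Prop :=
  forall a : S, z * a = z /\ a * z = z.

Definition flat_semiring (S : alg) : Prop :=
  ai_semiring S /\
  exists z : S, mul_zero z /\ forall a b : S, a <> b -> a + b = z.

Definition nilpotent3 (S : alg) : Prop :=
  exists z : S, mul_zero z /\ forall a b c : S, a * b * c = z.

Definition NF3 : set alg :=
  generated_variety [set S | flat_semiring S /\ nilpotent3 S].

Definition antichain (T : Type) (C : set (set T)) : Prop :=
  forall V W, C V -> C W -> V `<=` W -> V = W.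

(* Main.v *)
Require Import Defs.
From mathcomp Require Import all_boot.
From mathcomp Require Import boolp classical_sets functions cardinality.

(** Upper bound.  By Birkhoff's theorem a variety is the class of models of the
    identities it satisfies ([sat_theory_variety]).  Every identity involves
    finitely many variables, so identities over the variables [nat] suffice
    ([sat_nat_theory_variety]); there are countably many of these, and hence at
    most continuum many varieties ([card_subvarieties_le]).

    Lower bound.  An injection [f] of a set [T] into itself yields a 3-nilpotent
    flat semiring [graph_alg f] consisting of [T], a zero and one further
    element, the common value of all products [a * f a]; the other products are
    zero.  The law of flat addition makes a sum of words nonzero only when all
    the words take the same nonzero value, so the term
      x_0 x_1 + x_1 x_2 + ... + x_(k-1) x_k + x_k x_0
    takes a nonzero value in [graph_alg f] exactly when [f] has a closed walk
    [a, f a, ..., f^(k+1) a = a] ([sat_cycle_term_graph]).  For the rotation of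
    a [p]-element cycle this means that [p] divides [k + 1].  Distinct primes do
    not divide one another, so the identities [cycle_term = x x x] of prime
    lengths are independent: imposing those outside a set [X] of indices of
    primes defines a subvariety [cycle_variety X], and
    [X `<=` Y] iff [cycle_variety X `<=` cycle_variety Y]
    ([cycle_variety_subset]).

    Thus the power set of [nat] embeds, as an ordered set, into the lattice of
    subvarieties, and it remains to see that this power set has a chain and an
    antichain of the cardinality of the continuum: lower cuts of infinite binary
    sequences in the lexicographic order ([lex_cut]), and sets that choose one
    element from each pair [{2n, 2n+1}] ([choice_of_pairs]). *)

Set Implicit Arguments.
Unset Strict Implicit.
Unset Printing Implicit Defensive.

Local Open Scope classical_set_scope.
Local Open Scope card_scope.
Local Open Scope alg_scope.

(** * Terms and identities *)

Inductive term (X : Type) : Type :=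
  | Var of X
  | Add of term X & term X
  | Mul of term X & term X.

Fixpoint eval (X : Type) (A : alg) (v : X -> A) (t : term X) : A :=
  match t with
  | Var x => v x
  | Add s t => eval v s + eval v t
  | Mul s t => eval v s * eval v t
  end.

Definition sat (X : Type) (e : term X * term X) (A : alg) : Prop :=
  forall v : X -> A, eval v e.1 = eval v e.2.

Definition theory (X : Type) (V : set alg) : set (term X * term X) :=
  [set e | V `<=` sat e].

Lemma eval_hom (X : Type) (A B : alg) (f : A -> B) (v : X -> A) t :
  is_hom f -> f (eval v t) = eval (f \o v) t.
Proof.
move=> [fD fM]; elim: t => [x|s IHs t IHt|s IHs t IHt] //=.
  by rewrite fD IHs IHt.
by rewrite fM IHs IHt.
Qed.

Lemma eval_prod (X I : Type) (A : I -> alg) (v : X -> prod_alg A) t i :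
  eval v t i = eval (v^~ i) t.
Proof. by elim: t => [x|s IHs t IHt|s IHs t IHt] //=; rewrite IHs IHt. Qed.

Lemma variety_sat (X : Type) (e : term X * term X) : variety (sat e).
Proof.
split=> [A B f fhom fsurj satA v|A B f fhom finj satB v|I A satA v].
- have [w fw] := choice (fun x => fsurj (v x)).
  have -> : v = f \o w by apply/funext => x /=; rewrite fw.
  by rewrite -!eval_hom // satA.
- by apply: finj; rewrite !eval_hom // satB.
- by apply: functional_extensionality_dep => i; rewrite !eval_prod satA.
Qed.

Lemma variety_bigcap (I : Type) (P : set I) (V : I -> set alg) :
  (forall i, P i -> variety (V i)) -> variety (\bigcap_(i in P) V i).
Proof.
move=> varV; split=> [A B f fhom fsurj VA|A B f fhom finj VB|J A VA] i Pi.
- by have [H _ _] := varV i Pi; exact: H fhom fsurj (VA i Pi).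
- by have [_ S _] := varV i Pi; exact: S fhom finj (VB i Pi).
- by have [_ _ P'] := varV i Pi; apply: P' => j; exact: VA.
Qed.

Lemma varietyI (V W : set alg) : variety V -> variety W -> variety (V `&` W).
Proof.
rewrite -bigcap2inE => varV varW.
by apply: variety_bigcap => -[|[|i]].
Qed.

Lemma variety_generated (K : set alg) : variety (generated_variety K).
Proof. by apply: variety_bigcap => W []. Qed.

(** * Birkhoff's theorem and the upper bound *)

(** The variables are the elements of [A] itself.  Refuting each identity that
    fails in [V] by one valuation, and collecting these valuations in a product,
    gives [w : A -> P] with [P] in [V] such that [eval w s = eval w t] only for
    identities of [V].  The subalgebra of [P] generated by the range of [w] is
    then relatively free, and it maps onto [A] because [A] satisfies these
    identities. *)
Theorem sat_theory_variety (V : set alg) (A : alg) :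
  variety V -> (forall e, theory (X := A) V e -> sat e A) -> V A.
Proof.
move=> [VH VS VP] modA.
have refute (i : {e : term A * term A | ~ theory V e}) :
    exists Bv : {B : alg & A -> B},
      V (projT1 Bv) /\
      eval (projT2 Bv) (sval i).1 <> eval (projT2 Bv) (sval i).2.
  case: i => e /= /existsNP[B /not_implyP[VB /existsNP[v ev]]].
  by exists (existT _ B v).
have [Bv BvP] := choice refute.
pose P := prod_alg (fun i => projT1 (Bv i)).
pose w : A -> P := fun a i => projT2 (Bv i) a.
(* an identity that holds under [w] has no refuting factor in [P] *)
have wP s t : eval w s = eval w t -> eval (@id A) s = eval (@id A) t.
  move=> wst; apply: (modA (s, t)); apply: contrapT => Vst.
  have [_] := BvP (exist _ (s, t) Vst); apply => /=.
  by have := congr1 (fun x : P => x (exist _ (s, t) Vst)) wst; rewrite !eval_prod.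
pose D := {x : P | exists t, eval w t = x}.
have DD (x y : D) : exists t, eval w t = sval x + sval y.
  by have [[s <-] [t <-]] := (svalP x, svalP y); exists (Add s t).
have DM (x y : D) : exists t, eval w t = sval x * sval y.
  by have [[s <-] [t <-]] := (svalP x, svalP y); exists (Mul s t).
have Dw a : exists t, eval w t = w a by exists (Var a).
have D_inh : inhabited D.
  by case: (alg_inhabited A) => a; split; exact: exist _ (w a) (Dw a).
pose DA := @Alg D (fun x y => exist _ _ (DD x y)) (fun x y => exist _ _ (DM x y))
  D_inh.
have VD : V DA.
  apply: (VS DA P (fun x : D => sval x)); last by apply: VP => i; case: (BvP i).
    by split.
  case=> x xP [y yP] /= xy; case: y / xy yP => yP.
  by congr exist; exact: Prop_irrelevance.
pose g (x : D) : A := eval id (sval (cid (svalP x))).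
have gE (x : D) t : eval w t = sval x -> g x = eval id t.
  by move=> wt; apply: wP; rewrite wt; case: cid.
apply: (VH DA A g) => // [|a]; last first.
  by exists (exist _ (w a) (Dw a)); rewrite (gE _ (Var a)).
split=> x y; have [[s ws] [t wt]] := (svalP x, svalP y).
  by rewrite (gE x s) // (gE y t) // (gE _ (Add s t)) //= ws wt.
by rewrite (gE x s) // (gE y t) // (gE _ (Mul s t)) //= ws wt.
Qed.

Fixpoint rename (X Y : Type) (f : X -> Y) (t : term X) : term Y :=
  match t with
  | Var x => Var (f x)
  | Add s t => Add (rename f s) (rename f t)
  | Mul s t => Mul (rename f s) (rename f t)
  end.

Fixpoint vars (X : Type) (t : term X) : seq X :=
  match t with
  | Var x => [:: x]
  | Add s t | Mul s t => vars s ++ vars t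
  end.

Lemma eval_rename (X Y : Type) (A : alg) (f : X -> Y) (v : Y -> A) t :
  eval v (rename f t) = eval (v \o f) t.
Proof. by elim: t => [x|s IHs t IHt|s IHs t IHt] //=; rewrite IHs IHt. Qed.

Lemma eq_in_eval (X : eqType) (A : alg) (v w : X -> A) t :
  {in vars t, v =1 w} -> eval v t = eval w t.
Proof.
elim: t => [x|s IHs t IHt|s IHs t IHt] /= vw; first by rewrite vw ?inE.
  by rewrite IHs ?IHt // => x xin; apply: vw; rewrite mem_cat xin ?orbT.
by rewrite IHs ?IHt // => x xin; apply: vw; rewrite mem_cat xin ?orbT.
Qed.

(** Numbering the variables that occur in an identity turns it into an
    equivalent identity over [nat]. *)
Lemma sat_nat_theory_variety (V : set alg) (A : alg) :
  variety V -> (forall e, theory (X := nat) V e -> sat e A) -> V A.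
Proof.
move=> varV modA; apply: sat_theory_variety => // -[s t] Vst v.
pose l : seq {classic A} := vars s ++ vars t.
pose k (a : {classic A}) := index a l.
pose e := (rename k s, rename k t).
have Ve : theory V e by move=> B VB u; rewrite !eval_rename; exact: Vst.
have [a0] := alg_inhabited A.
have := modA e Ve (v \o nth (a0 : {classic A}) l); rewrite !eval_rename /=.
have vE r : {subset vars (r : term {classic A}) <= l} ->
    eval ((v \o nth (a0 : {classic A}) l) \o k) r = eval v r.
  by move=> rl; apply: eq_in_eval => x /rl xl; rewrite /= nth_index.
by rewrite !vE // => x xin; rewrite mem_cat xin ?orbT.
Qed.

Fixpoint tree_of_term (t : term nat) : GenTree.tree nat :=
  match t with
  | Var n => GenTree.Leaf n
  | Add s t => GenTree.Node 0 [:: tree_of_term s; tree_of_term t]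
  | Mul s t => GenTree.Node 1 [:: tree_of_term s; tree_of_term t]
  end.

Lemma tree_of_term_inj : injective tree_of_term.
Proof.
elim=> [n|s1 IH1 s2 IH2|s1 IH1 s2 IH2] [m|t1 t2|t1 t2] //= [].
- by move=> ->.
- by move=> /IH1 -> /IH2 ->.
- by move=> /IH1 -> /IH2 ->.
Qed.

Definition code (e : term nat * term nat) : nat :=
  pickle (tree_of_term e.1, tree_of_term e.2).

Lemma code_inj : injective code.
Proof.
move=> [s t] [s' t'] /(pcan_inj pickleK)[].
by move=> /tree_of_term_inj -> /tree_of_term_inj ->.
Qed.

(** A variety is determined by the set of codes of its identities over [nat]. *)
Lemma card_subvarieties_le (V : set alg) : subvarieties V #<= [set: set nat].
Proof.
pose th W := code @` theory W.
have th_sub W W' : variety W' -> th W = th W' -> W `<=` W'.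
  move=> varW' thWW' A WA; apply: sat_nat_theory_variety => // e W'e.
  have : th W (code e) by rewrite thWW'; exists e.
  by case=> e' We' /code_inj <-; exact: We'.
have th_inj : {in subvarieties V &, injective th}.
  move=> W W'; rewrite !inE => -[varW _] [varW' _] thWW'.
  by apply/seteqP; split; apply: th_sub.
have := inj_card_eq th_inj; rewrite card_eq_le => /andP[_ /card_le_trans].
by apply; exact: subset_card_le.
Qed.

(** * The flat semiring of an injective map *)

Section GraphAlgebra.
Variables (T : Type) (f : T -> T).

(** The zero is [None], and [Some None] is the common value of the nonzero
    products. *)
Definition graph_add (x y : option (option T)) := if `[< x = y >] then x else None.

Definition graph_mul (x y : option (option T)) : option (option T) :=
  match x, y with
  | Some (Some a), Some (Some b) => if `[< b = f a >] then Some None else None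
  | _, _ => None
  end.

Definition graph_alg : alg := Alg graph_add graph_mul (inhabits None).

Lemma graph_mulP (x y : graph_alg) :
  x * y = Some None <-> exists a, x = Some (Some a) /\ y = Some (Some (f a)).
Proof.
split=> [|[a [-> ->]]]; last by rewrite /= asboolT.
by case: x y => [[a|]|] [[b|]|] //=; case: asboolP => // -> _; exists a.
Qed.

Lemma graph_mul_or (x y : graph_alg) : x * y = Some None \/ x * y = None.
Proof. by case: x y => [[a|]|] [[b|]|] /=; try case: ifP; auto. Qed.

Lemma graph_addP (x y : graph_alg) :
  x + y = Some None <-> x = Some None /\ y = Some None.
Proof. by split=> [|[-> ->]//]; rewrite /= /graph_add; case: asboolP => // <-. Qed.

Lemma graph_addxx (x : graph_alg) : x + x = x.
Proof. by rewrite /= /graph_add asboolT. Qed.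

Lemma graph_add_neq (x y : graph_alg) : x <> y -> x + y = None.
Proof. by rewrite /= /graph_add; case: asboolP. Qed.

Lemma graph_mul_zero : mul_zero (None : graph_alg).
Proof. by move=> [[a|]|]. Qed.

Lemma graph_nilpotent (x y z : graph_alg) :
  x * y * z = None /\ x * (y * z) = None.
Proof.
by split; [case: (graph_mul_or x y) => ->|case: (graph_mul_or y z) => ->];
  [|case: z => [[]|]|case: x => [[]|]|case: x => [[]|]].
Qed.

Lemma graph_addC : commutative (@add graph_alg).
Proof.
move=> x y; have [->//|xy] := EM (x = y).
by rewrite !graph_add_neq // => /esym.
Qed.

Lemma graph_add0 (x : graph_alg) : (None : graph_alg) + x = None.
Proof. by have [<-|/graph_add_neq] := EM (None = x :> graph_alg); rewrite ?graph_addxx. Qed.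

Lemma graph_addA : associative (@add graph_alg).
Proof.
move=> x y z; have [<-|yz] := EM (y = z).
  rewrite graph_addxx; have [->|/graph_add_neq ->] := EM (x = y).
    by rewrite !graph_addxx.
  by rewrite graph_add0.
rewrite (graph_add_neq yz) [RHS]graph_addC [LHS]graph_addC graph_add0.
have [->|/graph_add_neq ->] := EM (x = y); last by rewrite graph_addC graph_add0.
by rewrite graph_addxx graph_addC graph_add_neq.
Qed.

(** Injectivity of [f] is 0-cancellativity of the multiplication, which is what
    distributivity over a flat addition amounts to. *)
Lemma graph_flat : injective f -> flat_semiring graph_alg.
Proof.
move=> finj; split; last first.
  by exists None; split; [exact: graph_mul_zero|exact: graph_add_neq].
split; [exact: graph_addA|exact: graph_addC|exact: graph_addxx| |].
  by move=> x y z; have [-> ->] := graph_nilpotent x y z.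
split=> x y z.
- have [->|xy] := EM (x = y); first by rewrite !graph_addxx.
  rewrite (graph_add_neq xy); have [->] := graph_mul_zero z.
  have [xz|/graph_add_neq-> //] := EM (x * z = y * z).
  rewrite xz graph_addxx; case: (graph_mul_or y z) => // yz; case: xy.
  move: xz; rewrite yz => /graph_mulP[a [-> za]].
  by move: yz => /graph_mulP[b [->]]; rewrite za => -[/finj->].
- have [->|yz] := EM (y = z); first by rewrite !graph_addxx.
  rewrite (graph_add_neq yz); have [_ ->] := graph_mul_zero x.
  have [xz|/graph_add_neq-> //] := EM (x * y = x * z).
  rewrite xz graph_addxx; case: (graph_mul_or x z) => // x_z; case: yz.
  move: xz; rewrite x_z => /graph_mulP[a [xa ->]].
  by move: x_z => /graph_mulP[b []]; rewrite xa => -[->] ->.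
Qed.

Lemma graph_NF3 : injective f -> NF3 graph_alg.
Proof.
move=> finj W [_ KW]; apply: KW; split; first exact: graph_flat.
exists None; split=> [|x y z]; first exact: graph_mul_zero.
by have [] := graph_nilpotent x y z.
Qed.

End GraphAlgebra.

(** * Closed walks *)

Fixpoint cycle_term_rec (k j : nat) : term nat :=
  match j with
  | 0 => Mul (Var k) (Var 0)
  | j'.+1 => Add (cycle_term_rec k j') (Mul (Var j') (Var j))
  end.

(** The sum of the words [x_i x_(i+1)] along the closed walk of length [k + 1]
    on the variables [x_0, ..., x_k]. *)
Definition cycle_term (k : nat) := cycle_term_rec k k.

(** A word of length three takes the value zero under every valuation in a
    3-nilpotent semiring, so it stands for a constant that the signature does
    not have. *)
Definition zero_term : term nat := Mul (Mul (Var 0) (Var 0)) (Var 0).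

Section ClosedWalks.
Variables (T : Type) (f : T -> T).
Local Notation S := (graph_alg f).

Lemma eval_cycle_termP (v : nat -> S) k j :
  eval v (cycle_term_rec k j) = Some None <->
  v k * v 0 = Some None /\ forall i, (i < j)%N -> v i * v i.+1 = Some None.
Proof.
elim: j => [|j IHj]; first by split=> [|[]].
split=> [/graph_addP[/IHj[vk vj] vS]|[vk vj]].
  by split=> // i; rewrite ltnS leq_eqVlt => /orP[/eqP->|/vj].
by apply/graph_addP; split; [apply/IHj; split=> // i ij; apply/vj/ltnW|exact: vj].
Qed.

Lemma eval_cycle_term_or (v : nat -> S) k j :
  eval v (cycle_term_rec k j) = Some None \/ eval v (cycle_term_rec k j) = None.
Proof.
case: j => [|j]; first exact: graph_mul_or.
have [e|/graph_add_neq] := EM (eval v (cycle_term_rec k j) = v j * v j.+1);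
  last by right.
have -> : eval v (cycle_term_rec k j.+1) = v j * v j.+1.
  by rewrite -[RHS]graph_addxx -{1}e.
exact: graph_mul_or.
Qed.

(** A valuation gives the cycle term a nonzero value only if it sends [x_0, ...,
    x_k] to consecutive points of an [f]-orbit and [f] sends the last of them
    back to the first. *)
Lemma sat_cycle_term_graph k :
  sat (cycle_term k, zero_term) S <-> forall a, iter k.+1 f a <> a.
Proof.
have zeroE (v : nat -> S) : eval v zero_term = None.
  by have [] := graph_nilpotent (v 0) (v 0) (v 0).
split=> [satS a fa|walk v] /=; last first.
  rewrite [LHS]/= [RHS]zeroE; case: (eval_cycle_term_or v k k) => //.
  move=> /eval_cycle_termP[/graph_mulP[b [vk v0]] vS].
  have vE i : (i <= k)%N -> v i = Some (Some (iter i.+1 f b)).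
    elim: i => // i IHi ik; have /graph_mulP[c [vi ->]] := vS i ik.
    by move: vi; rewrite IHi 1?ltnW // => -[<-].
  by case: (walk b); move: (vE k (leqnn k)); rewrite vk => -[{2}->].
have := satS (fun i => Some (Some (iter i f a))); rewrite [RHS]zeroE.
have -> // : eval (A := S) (fun i => Some (Some (iter i f a))) (cycle_term k)
  = Some None.
apply/eval_cycle_termP; split=> [|i _]; apply/graph_mulP.
  by exists (iter k f a); rewrite -iterS fa.
by exists (iter i f a).
Qed.

End ClosedWalks.

(** * Cycles of prime length *)

Definition cycle p := {i : nat | (i < p)%N}.

Definition rotation p (a : cycle p) : cycle p :=
  exist _ ((sval a).+1 %% p)%N (ltn_pmod _ (leq_ltn_trans (leq0n _) (svalP a))).

Lemma rotation_inj p : injective (@rotation p).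
Proof.
move=> [a ap] [b bp] /(congr1 sval) /= /eqP.
by rewrite -(addn1 a) -(addn1 b) eqn_modDr !modn_small // => /eqP ab; apply: val_inj.
Qed.

Lemma sval_iter_rotation p (a : cycle p) k :
  sval (iter k (@rotation p) a) = ((sval a + k) %% p)%N.
Proof.
elim: k => [|k IHk] /=; first by rewrite addn0 modn_small //; exact: svalP a.
by rewrite IHk addnS -addn1 modnDml addn1.
Qed.

Lemma iter_rotation_fix p (a : cycle p) k :
  iter k (@rotation p) a = a <-> (p %| k)%N.
Proof.
have ap := svalP a; split=> [/(congr1 sval)|pk].
  rewrite sval_iter_rotation => ak.
  by rewrite /dvdn -(mod0n p) -(eqn_modDl (sval a)) ak addn0 modn_small.
apply: val_inj; apply: etrans (sval_iter_rotation a k) _.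
by rewrite -modnDmr (eqP pk) addn0 modn_small.
Qed.

Definition prime_seq n := iter n (fun m => s2val (prime_above m)) 2.

Lemma prime_prime_seq n : prime (prime_seq n).
Proof. by case: n => //= n; case: prime_above. Qed.

Lemma prime_seq_inj : injective prime_seq.
Proof.
apply: incn_inj; apply: leq_mono; apply: homo_ltn; first exact: ltn_trans.
by move=> n /=; case: prime_above.
Qed.

Definition cycle_identity n := (cycle_term (prime_seq n).-1, zero_term).

Lemma sat_cycle_identity m n :
  sat (cycle_identity m) (graph_alg (@rotation (prime_seq n))) <-> m <> n.
Proof.
have [pm pn] := (prime_prime_seq m, prime_prime_seq n).
rewrite sat_cycle_term_graph prednK ?prime_gt0 //.
split=> [walk mn|mn a /iter_rotation_fix].
  apply: (walk (exist _ 0 (prime_gt0 pn))).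
  by apply/iter_rotation_fix; rewrite mn.
by rewrite dvdn_prime2 // => /eqP /prime_seq_inj /esym.
Qed.

(** The cycles of the lengths indexed by [X] satisfy all the identities imposed
    here, and a cycle of any other prime length violates one of them. *)
Definition cycle_variety (X : set nat) : set alg :=
  NF3 `&` \bigcap_(n in ~` X) sat (cycle_identity n).

Lemma cycle_variety_subvariety X : subvarieties NF3 (cycle_variety X).
Proof.
split=> [|A []//]; apply: varietyI; first exact: variety_generated.
by apply: variety_bigcap => n _; exact: variety_sat.
Qed.

Lemma cycle_variety_subset X Y :
  cycle_variety X `<=` cycle_variety Y <-> X `<=` Y.
Proof.
split=> [XY n Xn|XY A [NFA AX]]; last by split=> // n Yn; apply: AX => /XY.
apply: contrapT => Yn.
have [|_ /(_ n Yn)/sat_cycle_identity//] :=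
  XY (graph_alg (@rotation (prime_seq n))).
split=> [|m Xm]; first exact: graph_NF3 (@rotation_inj _).
by apply/sat_cycle_identity => mn; apply: Xm; rewrite mn.
Qed.

Lemma cycle_variety_inj : injective cycle_variety.
Proof.
by move=> X Y XY; apply/seteqP; split; apply/cycle_variety_subset; rewrite XY.
Qed.

(** * Chains and antichains of sets of natural numbers *)

(** The set [X] is read as an infinite binary sequence; its cut consists of the
    codes of the finite sequences that lie lexicographically below it.  Between
    two different infinite sequences there is a finite one, so the cuts form a
    chain on which the uncountable lexicographic order is faithfully
    represented by subsets of a countable set. *)
Definition lex_cut (X : set nat) : set nat :=
  [set pickle s | s in [set s : seq bool | exists k,
    [/\ (k < size s)%N, X k, ~~ nth false s k &
        forall i, (i < k)%N -> nth false s i <-> X i]]].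

Lemma lex_cut_subset X Y k :
  ~ X k -> Y k -> (forall i, (i < k)%N -> X i <-> Y i) ->
  lex_cut X `<=` lex_cut Y /\ ~ lex_cut Y `<=` lex_cut X.
Proof.
move=> Xk Yk XY; split=> [_ [s [j [js Xj sj sX]] <-]|YX].
  exists s => //; case: (ltngtP j k) => [jk|kj|jk]; last by rewrite jk in Xj.
    exists j; split=> // [|i ij]; first exact/XY.
    by rewrite -XY ?sX //; exact: ltn_trans jk.
  exists k; split=> // [||i ik]; first exact: ltn_trans js.
    by apply/negP => /sX-/(_ kj).
  by rewrite -XY // sX //; exact: ltn_trans kj.
(* the initial segment of [X] of length [k + 1] separates the two cuts *)
pose s := mkseq (fun i => `[<X i>]) k.+1.
have sE i : (i < k.+1)%N -> nth false s i = `[<X i>] by exact: nth_mkseq.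
have /YX[s' [j [js Xj sj _]]] : lex_cut Y (pickle s).
  exists s => //; exists k; split=> // [||i ik]; first by rewrite size_mkseq.
    by rewrite sE //; apply/asboolP.
  by rewrite sE 1?ltnW // -XY //; split=> /asboolP.
move=> /(pcan_inj pickleK) ss'; move: js sj; rewrite ss' size_mkseq => js.
by rewrite sE // => /asboolP.
Qed.

Lemma first_difference (X Y : set nat) : X <> Y ->
  exists k, (X k <-> ~ Y k) /\ forall i, (i < k)%N -> X i <-> Y i.
Proof.
move=> XY; have ex : exists k, `[<~ (X k <-> Y k)>].
  apply: contrapT => no; apply: XY; apply/seteqP; split=> k Zk;
    by apply: contrapT => nZk; apply: no; exists k; apply/asboolP => -[XY YX];
      apply: nZk; auto.
case: (ex_minnP ex) => k /asboolP Xk kmin; exists k; split.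
  by split=> [x y|y]; [|apply: contrapT => x]; apply: Xk; split=> // /y.
move=> i; rewrite ltnNge => /negP ik; apply: contrapT => Xi.
by apply: ik; apply: kmin; apply/asboolP.
Qed.

Lemma lex_cut_total X Y :
  X <> Y -> (lex_cut X `<=` lex_cut Y /\ ~ lex_cut Y `<=` lex_cut X) \/
            (lex_cut Y `<=` lex_cut X /\ ~ lex_cut X `<=` lex_cut Y).
Proof.
move=> /first_difference[k [XYk XYi]]; have [Xk|Xk] := EM (X k).
  by right; apply: (@lex_cut_subset _ _ k) => //; [exact/XYk|move=> i /XYi[]].
left; apply: (@lex_cut_subset _ _ k) => //.
by apply: contrapT => Yk; apply/Xk/XYk.
Qed.

Lemma lex_cut_inj : injective lex_cut.
Proof.
move=> X Y cXY; apply: contrapT => /lex_cut_total.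
by rewrite cXY => -[] [].
Qed.

(** From each pair [{2n, 2n+1}] the odd member is chosen when [n] is in [X], and
    the even one otherwise.  A choice cannot be properly contained in another
    choice, which makes these sets an antichain. *)
Definition choice_of_pairs (X : set nat) : set nat :=
  [set n | odd n <-> X n./2].

Lemma choice_of_pairs_antichain X Y :
  choice_of_pairs X `<=` choice_of_pairs Y -> X = Y.
Proof.
move=> XY; apply/seteqP; split=> n.
  move=> Xn; have [|] := XY n.*2.+1.
    by split; rewrite /= ?odd_double // uphalf_double.
  by rewrite /= odd_double uphalf_double => /(_ isT).
move=> Yn; apply: contrapT => Xn; have [|_] := XY n.*2.
  by split; rewrite odd_double // doubleK.
by rewrite doubleK odd_double => /(_ Yn).
Qed.

(** * Embedding the power set of the natural numbers *)

Lemma cycle_varieties_continuum (g : set nat -> set nat) : injective g ->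
  range (cycle_variety \o g) `<=` subvarieties NF3 /\
  range (cycle_variety \o g) #= [set: set nat].
Proof.
move=> ginj; split=> [_ [X _ <-]|]; first exact: cycle_variety_subvariety.
by apply: inj_card_eq; apply: in2W => X Y /cycle_variety_inj/ginj.
Qed.

Theorem theorem2p6 :
  subvarieties NF3 #= [set: set nat] /\
  (exists C : set (set alg),
     [/\ C `<=` subvarieties NF3, total_on C subset & C #= [set: set nat]]) /\
  (exists C : set (set alg),
     [/\ C `<=` subvarieties NF3, antichain C & C #= [set: set nat]]).
Proof.
have [chain_sub chain_card] := cycle_varieties_continuum lex_cut_inj.
split; [|split].
- rewrite card_eq_le card_subvarieties_le /=.
  move: chain_card; rewrite card_eq_le => /andP[_ /card_le_trans]; apply.
  exact: subset_card_le.
- exists (range (cycle_variety \o lex_cut)); split=> //.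
  move=> _ _ [X _ <-] [Y _ <-]; have [->|] := EM (X = Y); first by left.
  by move=> /lex_cut_total[] [XY _]; [left|right]; apply/cycle_variety_subset.
- have cinj : injective choice_of_pairs.
    by move=> X Y XY; apply: choice_of_pairs_antichain; rewrite XY.
  have [anti_sub anti_card] := cycle_varieties_continuum cinj.
  exists (range (cycle_variety \o choice_of_pairs)); split=> //.
  move=> _ _ [X _ <-] [Y _ <-] /cycle_variety_subset.
  by move=> /choice_of_pairs_antichain ->.
Qed.
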